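(* Let $K$ be a field of characteristic not equal to $2$ and let $0\le k<n$ be integers. Define $$F_\ell(\mathrm{Sym}^{n,\le k}):=\pi_k^{-1}(\mathrm{Sym}^{n-1,\le \ell}),\qquad 0\le \ell\le k.$$ This is an increasing filtration of $\mathrm{Sym}^{n,\le k}$ of length $k+1$, with $F_k(\mathrm{Sym}^{n,\le k})=\mathrm{Sym}^{n,\le k}$, and it gives a commutative triangular diagram in $\mathrm{Var}_K$ as follows. For $0\le i\le k+1$ and $i-1\le j\le k$ put $Y_{i,j}:=\pi_k^{-1}(\mathrm{Sym}^{n-1,[i,j]})$, so that $Y_{i,i-1}=\emptyset$ and $Y_{0,j}=F_j(\mathrm{Sym}^{n,\le k})$ for $j \ge 0$. Then: (1) the inclusions $Y_{i,j}\to Y_{i,j+1}$ (the horizontal morphisms) are closed embeddings; (2) the inclusions $Y_{i+1,j}\to Y_{i,j}$ (the vertical morphisms) are open immersions; (3) for all $0\le i\le j\le m\le k$, the image of $Y_{j+1,m}\to Y_{i,m}$ is the complement of the closed embedding $Y_{i,j}\to Y_{i,m}$.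
   Context: $\mathrm{Var}_K$ is the category of separated schemes of finite type over $K$. $\mathrm{Sym}^{n,\le k}$ is the closed subvariety of the affine space $\mathbb{A}^{n(n+1)/2}$ of $n\times n$ symmetric matrices given by the vanishing of all $(k+1)\times(k+1)$ minors (matrices of rank at most $k$). $\mathrm{Sym}^{n,[k,\ell]}$ is the variety of $n\times n$ symmetric matrices of rank $m$ with $k\le m\le\ell$ (empty if $\ell<k$). The morphism $\pi_k:\mathrm{Sym}^{n,\le k}\to\mathrm{Sym}^{n-1,\le k}$ sends a matrix $(x_{ij})_{i,j=1,\dots,n}$ to its ''(1,1) minor'', i.e. the submatrix $(x_{ij})_{i,j=2,\dots,n}$. *)

(* Defs.v *)
From HB Require Import structures.
From Stdlib Require Import ProofIrrelevance.
From mathcomp Require Import all_boot all_order all_algebra.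
From mathcomp Require Import mpoly.

Set Implicit Arguments.
Unset Strict Implicit.
Unset Printing Implicit Defensive.

Import GRing.Theory.
Local Open Scope ring_scope.
Local Obligation Tactic := idtac.

(* Schemes over K are represented by their functors of points (Demazure-
   Gabriel, Jantzen): a K-scheme is a functor from commutative K-algebras to
   sets that is a Zariski sheaf and is covered by open affine subfunctors.
   The zero algebra has to be among the K-algebras, hence comPzRingType with a
   structure map rather than comAlgType, whose carriers are nonzero. *)

Section Algebras.
Variable K : fieldType.

Record kalg := KAlg {
  kcarrier :> comPzRingType;
  kstr : {rmorphism K -> kcarrier} }.

Record khom (A B : kalg) := KHom {
  khom_fun :> {rmorphism A -> B};
  khomP : forall c : K, khom_fun (kstr A c) = kstr B c }.

Definition unit_ideal (A : kalg) (T : A -> Prop) : Prop :=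
  exists (m : nat) (c t : 'I_m -> A),
    (forall i, T (t i)) /\ \sum_(i < m) c i * t i = 1.

(* B is the localization A_f, with structure map h. *)
Definition is_localization (A B : kalg) (f : A) (h : A -> B) : Prop :=
  [/\ exists u : B, u * h f = 1,
      forall b : B, exists (a : A) (m : nat), b * h f ^+ m = h a
    & forall a : A, h a = 0 -> exists m : nat, f ^+ m * a = 0].

(* The library's mmap only evaluates into nonzero rings. *)
Definition eval_mpoly (N : nat) (A : kalg) (v : 'rV[A]_N) (p : {mpoly K[N]}) : A :=
  \sum_(m <- msupp p) kstr A p@_m * \prod_(i < N) v 0 i ^+ m i.

End Algebras.

Section Functors.
Variable K : fieldType.

Record kfunctor := KFunctor {
  fpt :> kalg K -> Type;
  fmap : forall A B : kalg K, khom A B -> fpt A -> fpt B;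
  fmap_id : forall (A : kalg K) (f : khom A A),
    f =1 id -> forall x : fpt A, fmap f x = x;
  fmap_comp : forall (A B C : kalg K) (f : khom A B) (g : khom B C) (h : khom A C),
    (forall a, h a = g (f a)) -> forall x : fpt A, fmap h x = fmap g (fmap f x) }.

Record kmor (X Y : kfunctor) := KMor {
  kmor_fun :> forall A : kalg K, X A -> Y A;
  kmor_nat : forall (A B : kalg K) (f : khom A B) (x : X A),
    kmor_fun (fmap f x) = fmap f (kmor_fun x) }.

Program Definition kmor_comp (X Y Z : kfunctor) (g : kmor Y Z) (f : kmor X Y) : kmor X Z :=
  KMor (kmor_fun := fun A x => g A (f A x)) _.
Next Obligation. by move=> X Y Z g f A B h x /=; rewrite !kmor_nat. Qed.

Definition kmor_eq (X Y : kfunctor) (f g : kmor X Y) : Prop :=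
  forall (A : kalg K) (x : X A), f A x = g A x.

Definition kiso (X Y : kfunctor) : Prop :=
  exists (f : kmor X Y) (g : kmor Y X),
    (forall A, cancel (f A) (g A)) /\ (forall A, cancel (g A) (f A)).

Program Definition kprod (X Y : kfunctor) : kfunctor :=
  @KFunctor (fun A => (X A * Y A)%type)
    (fun A B f xy => (fmap f xy.1, fmap f xy.2)) _ _.
Next Obligation. by move=> X Y A f fE [x y] /=; rewrite !fmap_id. Qed.
Next Obligation.
by move=> X Y A B C f g h hE [x y] /=; rewrite !(fmap_comp hE).
Qed.

Program Definition kdiag (X : kfunctor) : kmor X (kprod X X) :=
  @KMor X (kprod X X) (fun A x => (x, x)) _.
Next Obligation. by []. Qed.

Record subfun (X : kfunctor) := SubFun {
  subpred :> forall A : kalg K, X A -> Prop;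
  subpredP : forall (A B : kalg K) (f : khom A B) (x : X A),
    subpred x -> subpred (fmap f x) }.

Definition subfun_le (X : kfunctor) (P Q : subfun X) : Prop :=
  forall (A : kalg K) (x : X A), P A x -> Q A x.

Definition subfun_eq (X : kfunctor) (P Q : subfun X) : Prop :=
  forall (A : kalg K) (x : X A), P A x <-> Q A x.

Definition subfun_full (X : kfunctor) : subfun X :=
  @SubFun X (fun _ _ => True) (fun _ _ _ _ _ => I).

Lemma sig_val_inj (T : Type) (P : T -> Prop) (u v : {x : T | P x}) :
  sval u = sval v -> u = v.
Proof.
case: u v => [x px] [y py] /= xy; case: y / xy py => py.
by rewrite (proof_irrelevance _ px py).
Qed.

Program Definition subfunctor (X : kfunctor) (P : subfun X) : kfunctor :=
  @KFunctor (fun A => {x : X A | P A x})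
    (fun A B f u => exist _ (fmap f (sval u)) (subpredP f (proj2_sig u))) _ _.
Next Obligation. by move=> X P A f fE [x px]; apply: sig_val_inj; apply: fmap_id. Qed.
Next Obligation.
by move=> X P A B C f g h hE [x px]; apply: sig_val_inj; apply: fmap_comp.
Qed.

Definition subfun_emb (X : kfunctor) (P : subfun X) : kmor (subfunctor P) X :=
  @KMor (subfunctor P) X (fun A u => sval u) (fun _ _ _ _ => erefl).

Program Definition incl (X : kfunctor) (P Q : subfun X) (PQ : subfun_le P Q) :
    kmor (subfunctor P) (subfunctor Q) :=
  @KMor (subfunctor P) (subfunctor Q)
    (fun A u => exist _ (sval u) (PQ A _ (proj2_sig u))) _.
Next Obligation. by move=> X P Q PQ A B f u; apply: sig_val_inj. Qed.

Program Definition preim (X Y : kfunctor) (f : kmor X Y) (P : subfun Y) : subfun X :=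
  @SubFun X (fun A x => P A (f A x)) _.
Next Obligation. by move=> X Y f P A B h x px /=; rewrite kmor_nat; apply: subpredP. Qed.

(* X -> Y is a monomorphism whose pullback along any Spec A -> Y is the closed
   subscheme V(S) of Spec A, for some subset S of A; likewise with the open
   subscheme D(S), the complement of V(S), for an open immersion. *)
Definition closed_immersion (X Y : kfunctor) (f : kmor X Y) : Prop :=
  (forall A, injective (f A)) /\
  forall (A : kalg K) (y : Y A), exists S : A -> Prop,
  forall (B : kalg K) (h : khom A B),
    (exists x : X B, f B x = fmap h y) <-> (forall a, S a -> h a = 0).

Definition open_immersion (X Y : kfunctor) (f : kmor X Y) : Prop :=
  (forall A, injective (f A)) /\
  forall (A : kalg K) (y : Y A), exists S : A -> Prop,
  forall (B : kalg K) (h : khom A B),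
    (exists x : X B, f B x = fmap h y) <->
    unit_ideal (fun b : B => exists2 a, S a & b = h a).

Definition closed_incl (X : kfunctor) (P Q : subfun X) : Prop :=
  exists PQ : subfun_le P Q, closed_immersion (incl PQ).

Definition open_incl (X : kfunctor) (P Q : subfun X) : Prop :=
  exists PQ : subfun_le P Q, open_immersion (incl PQ).

(* The points of the underlying space of X are represented by morphisms
   Spec L -> X with L a field; two of them give the same point when they agree
   over a common field extension. *)
Record kpoint (X : kfunctor) := KPoint {
  kp_field : fieldType;
  kp_str : {rmorphism K -> kp_field};
  kp_val : X (KAlg kp_str) }.

Definition same_point (X : kfunctor) (p q : kpoint X) : Prop :=
  exists (M : fieldType) (iM : {rmorphism K -> M})
    (f : khom (KAlg (@kp_str X p)) (KAlg iM)) (g : khom (KAlg (@kp_str X q)) (KAlg iM)),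
    fmap f (kp_val p) = fmap g (kp_val q).

Definition push_point (X Y : kfunctor) (f : kmor X Y) (p : kpoint X) : kpoint Y :=
  @KPoint Y (kp_field p) (@kp_str X p) (f _ (kp_val p)).

Definition in_image (X Y : kfunctor) (f : kmor X Y) (p : kpoint Y) : Prop :=
  exists q : kpoint X, same_point (push_point f q) p.

Definition image_is_complement (U Z X : kfunctor) (u : kmor U X) (z : kmor Z X) : Prop :=
  forall p : kpoint X, in_image u p <-> ~ in_image z p.

Definition zariski_sheaf (X : kfunctor) : Prop :=
  forall (A : kalg K) (r : nat) (f : 'I_r -> A)
    (B : 'I_r -> kalg K) (loc : forall i, khom A (B i))
    (C : 'I_r -> 'I_r -> kalg K)
    (resl : forall i j, khom (B i) (C i j)) (resr : forall i j, khom (B j) (C i j)),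
    (exists c : 'I_r -> A, \sum_(i < r) c i * f i = 1) ->
    (forall i, is_localization (f i) (loc i)) ->
    (forall i j, is_localization (f i * f j) (fun a => resl i j (loc i a))) ->
    (forall i j a, resl i j (loc i a) = resr i j (loc j a)) ->
  forall x : (forall i, X (B i)),
    (forall i j, fmap (resl i j) (x i) = fmap (resr i j) (x j)) ->
  exists! y : X A, forall i, fmap (loc i) y = x i.

Program Definition affine_space (N : nat) : kfunctor :=
  @KFunctor (fun A => 'rV[A]_N) (fun A B f v => map_mx f v) _ _.
Next Obligation. by move=> N A f fE v; apply/matrixP => i j; rewrite mxE fE. Qed.
Next Obligation.
by move=> N A B C f g h hE v; apply/matrixP => i j; rewrite !mxE hE.
Qed.

Lemma eval_mpoly_map (N : nat) (A B : kalg K) (f : khom A B) (v : 'rV[A]_N)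
    (p : {mpoly K[N]}) :
  eval_mpoly (map_mx f v) p = f (eval_mpoly v p).
Proof.
rewrite /eval_mpoly rmorph_sum; apply: eq_bigr => m _.
rewrite rmorphM khomP rmorph_prod; congr (_ * _).
by apply: eq_bigr => i _; rewrite mxE rmorphXn.
Qed.

(* Spec K[T_1, ..., T_N] / (S), whose A-points are the zeros of S in A^N. *)
Program Definition zero_locus (N : nat) (S : {mpoly K[N]} -> Prop) :
    subfun (affine_space N) :=
  @SubFun (affine_space N) (fun A v => forall p, S p -> eval_mpoly v p = 0) _.
Next Obligation.
by move=> N S A B f v vS p Sp /=; rewrite eval_mpoly_map vS // rmorph0.
Qed.

Definition affine_finite_type (X : kfunctor) : Prop :=
  exists (N : nat) (S : {mpoly K[N]} -> Prop), kiso X (subfunctor (zero_locus S)).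

(* Objects of Var_K.  Finitely many open subfunctors cover X when every point
   with values in a field lies in one of them. *)
Definition is_var (X : kfunctor) : Prop :=
  [/\ zariski_sheaf X,
      exists (r : nat) (U : 'I_r -> subfun X),
        [/\ forall i, open_immersion (subfun_emb (U i)),
            forall i, affine_finite_type (subfunctor (U i))
          & forall p : kpoint X, exists i, U i _ (kp_val p)]
    & closed_immersion (kdiag X)].

(* The A-points of the empty scheme: none unless A = 0. *)
Definition subfun_empty (X : kfunctor) (P : subfun X) : Prop :=
  forall (A : kalg K) (x : X A), P A x <-> 1 = 0 :> A.

End Functors.

Section SymmetricMatrices.
Variable K : fieldType.

Definition is_minor (A : comPzRingType) (n r : nat) (x : 'M[A]_n) (a : A) : Prop :=
  exists f g : 'I_r -> 'I_n,
    [/\ {homo f : i j / (i < j)%N}, {homo g : i j / (i < j)%N}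
      & a = \det (mxsub f g x)].

Lemma is_minor_map (A B : kalg K) (h : khom A B) (n r : nat) (x : 'M[A]_n) (b : B) :
  is_minor r (map_mx h x) b <-> exists2 a, is_minor r x a & b = h a.
Proof.
split=> [[f [g [fi gi ->]]] | [_ [f [g [fi gi ->]]] ->]].
  by exists (\det (mxsub f g x)); [exists f, g | rewrite -det_map_mx map_mxsub].
by exists f, g; rewrite -det_map_mx map_mxsub.
Qed.

Program Definition Sym (n : nat) : kfunctor K :=
  @KFunctor K (fun A => {x : 'M[A]_n | x^T = x})
    (fun A B f u => exist _ (map_mx f (sval u)) _) _ _.
Next Obligation. by move=> n A B f [x xT] /=; rewrite map_trmx xT. Qed.
Next Obligation.
by move=> n A f fE [x xT]; apply: sig_val_inj; apply/matrixP => i j; rewrite mxE fE.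
Qed.
Next Obligation.
move=> n A B C f g h hE [x xT]; apply: sig_val_inj.
by apply/matrixP => i j; rewrite !mxE hE.
Qed.

Program Definition sym_le (n k : nat) : subfun (Sym n) :=
  @SubFun K (Sym n) (fun A x => forall a, is_minor k.+1 (sval x) a -> a = 0) _.
Next Obligation.
by move=> n k A B f x xk b /is_minor_map[a /xk -> ->]; rewrite rmorph0.
Qed.

Definition SymLe (n k : nat) : kfunctor K := subfunctor (sym_le n k).

(* The locus where the rank is everywhere at least k, i.e. the open complement
   of the vanishing locus of the k x k minors. *)
Program Definition sym_ge (n k : nat) : subfun (Sym n) :=
  @SubFun K (Sym n) (fun A x => unit_ideal (is_minor k (sval x))) _.
Next Obligation.
move=> n k A B f x [m [c [t [tk ct]]]].
exists m, (fun i => f (c i)), (fun i => f (t i)); split=> [i|].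
  by apply/is_minor_map; exists (t i).
by rewrite -(rmorph1 f) -ct rmorph_sum; apply: eq_bigr => i _; rewrite rmorphM.
Qed.

(* l is an integer because l = -1 occurs in Yij.  For 0 <= l < k the two rank
   conditions are contradictory, so that the subscheme is empty as well. *)
Program Definition sym_range (n k : nat) (l : int) : subfun (Sym n) :=
  @SubFun K (Sym n) (fun A x =>
    match l with
    | Posz l' => sym_ge n k A x /\ sym_le n l' A x
    | Negz _ => 1 = 0 :> A
    end) _.
Next Obligation.
move=> n k [l|l] A B f x /=; last by move=> A0; rewrite -(rmorph1 f) A0 rmorph0.
by case=> xk xl; split; [apply: (@subpredP _ _ (sym_ge n k) A B f x xk) | apply: (@subpredP _ _ (sym_le n l) A B f x xl)].
Qed.

Lemma skip1_proof (n : nat) (i : 'I_n.-1) : (i.+1 < n)%N.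
Proof. by case: n i => [|n] i; [case: i | exact: (ltn_ord i)]. Qed.

Definition skip1 (n : nat) (i : 'I_n.-1) : 'I_n := Ordinal (skip1_proof i).

Program Definition del11 (n : nat) : kmor (Sym n) (Sym n.-1) :=
  @KMor K (Sym n) (Sym n.-1)
    (fun A x => exist _ (mxsub (@skip1 n) (@skip1 n) (sval x)) _) _.
Next Obligation. by move=> n A [x xT] /=; rewrite trmx_mxsub xT. Qed.
Next Obligation.
by move=> n A B f x; apply: sig_val_inj; rewrite /= map_mxsub.
Qed.

Lemma del11_le (n k : nat) (A : kalg K) (x : Sym n A) :
  sym_le n k A x -> sym_le n.-1 k A (del11 n A x).
Proof.
move=> xk a [f [g [fi gi ->]]]; apply: xk.
exists (fun i => skip1 (f i)), (fun i => skip1 (g i)); split.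
- by move=> i j /fi; rewrite /= ltnS.
- by move=> i j /gi; rewrite /= ltnS.
- by congr (\det _); apply/matrixP => i j; rewrite !mxE.
Qed.

Program Definition sym_pi (n k : nat) : kmor (SymLe n k) (SymLe n.-1 k) :=
  @KMor K (SymLe n k) (SymLe n.-1 k)
    (fun A u => exist _ (del11 n A (sval u)) (del11_le (proj2_sig u))) _.
Next Obligation. by move=> n k A B f u; apply: sig_val_inj; exact: (kmor_nat (del11 n) f (sval u)). Qed.

(* An open or closed locus of Sym^{n-1}, viewed inside Sym^{n-1,<=k} and then
   pulled back along pi_k. *)
Definition sym_pi_preim (n k : nat) (P : subfun (Sym n.-1)) : subfun (SymLe n k) :=
  preim (sym_pi n k) (preim (subfun_emb (sym_le n.-1 k)) P).

Definition Fil (n k l : nat) : subfun (SymLe n k) :=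
  sym_pi_preim k (sym_le n.-1 l).

Definition Yij (n k i : nat) (j : int) : subfun (SymLe n k) :=
  sym_pi_preim k (sym_range n.-1 i j).

End SymmetricMatrices.

(* Main.v *)
From Stdlib Require Import ClassicalEpsilon.
From HB Require Import structures.
Require Import Defs.
From mathcomp Require Import all_boot all_order all_algebra ring.
From mathcomp Require Import mpoly.

Set Implicit Arguments.
Unset Strict Implicit.
Unset Printing Implicit Defensive.

Import GRing.Theory.
Local Open Scope ring_scope.

(** Everything is read off from the A-points, for an arbitrary commutative
    K-algebra A.  For a symmetric matrix x over A, let x' be x without its first
    row and column.  Then x lies in Y_{i,j} when the (k+1)-minors of x and the
    (j+1)-minors of x' vanish and the i-minors of x' generate the unit ideal
    ([sym_rangeP]; for j = -1 the equation is 1 = 0).  Laplace expansion puts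
    the (r+1)-minors into the ideal generated by the r-minors
    ([is_minor_expand]), so the conditions for different i and j are nested.
    Inside Y_{i,m}, the subscheme Y_{i,j} is cut out by the vanishing of the
    (j+1)-minors of x', and Y_{j+1,m} by the condition that the same minors
    generate the unit ideal.  As minors commute with base change, the former is
    a closed and the latter an open subscheme ([closed_immersion_of_equations],
    [open_immersion_of_equations]); over a field the two conditions are
    complementary, and they are insensitive to field extensions
    ([image_complement_of_equations]).

    The remaining point is that these functors are separated schemes of finite
    type.  This holds for any locally closed subfunctor of affine N-space given
    by the vanishing of a set S of polynomials together with the condition that
    finitely many polynomials T_i generate the unit ideal
    ([locus_embedding_var]).  It is a Zariski sheaf because sections over the
    localizations glue uniquely ([glue_sections], [loc_inj]) and both conditions
    are local ([ideal_of_local]); it is covered by the loci where one T_i is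
    invertible, and each of these is a closed subscheme of affine (N+1)-space,
    the last coordinate being the inverse of T_i; and two of its points agree
    exactly where the differences of their coordinates vanish. *)

(** * Ideals generated by a subset *)

Section Ideals.

(** The ideal of [A] generated by [T]. *)
Inductive ideal_of (A : comPzRingType) (T : A -> Prop) : A -> Prop :=
| ideal_of0 : ideal_of T 0
| ideal_of_cons c t a : T t -> ideal_of T a -> ideal_of T (c * t + a).

Variable A : comPzRingType.
Implicit Types (T : A -> Prop) (a b c : A).

Lemma ideal_of_gen T t : T t -> ideal_of T t.
Proof.
move=> Tt; rewrite -[t]addr0 -[in X in ideal_of _ X](mul1r t).
by apply: ideal_of_cons => //; apply: ideal_of0.
Qed.

Lemma ideal_ofD T a b : ideal_of T a -> ideal_of T b -> ideal_of T (a + b).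
Proof.
by move=> Ta Tb; elim: Ta => [|c t d Tt _ IH]; rewrite ?add0r // -addrA;
  apply: ideal_of_cons.
Qed.

Lemma ideal_ofMl T c a : ideal_of T a -> ideal_of T (c * a).
Proof.
elim=> [|d t b Tt _ IH]; first by rewrite mulr0; apply: ideal_of0.
by rewrite mulrDr mulrA; apply: ideal_of_cons.
Qed.

Lemma ideal_of_sum T (I : finType) (F : I -> A) :
  (forall i, ideal_of T (F i)) -> ideal_of T (\sum_i F i).
Proof.
move=> TF; apply: big_ind => [||i _]; [exact: ideal_of0 | exact: ideal_ofD|].
exact: TF.
Qed.

Lemma ideal_of_le T T' :
  (forall t, T t -> ideal_of T' t) -> forall a, ideal_of T a -> ideal_of T' a.
Proof.
move=> TT' a; elim=> [|c t b Tt _ IH]; first exact: ideal_of0.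
by apply: ideal_ofD => //; apply/ideal_ofMl/TT'.
Qed.

Lemma ideal_of_zero T : (forall t, T t -> t = 0) ->
  forall a, ideal_of T a -> a = 0.
Proof. by move=> T0 a; elim=> // c t b /T0-> _ ->; rewrite mulr0 addr0. Qed.

Lemma ideal_of_trivial T a : 1 = 0 :> A -> ideal_of T a.
Proof. by move=> A0; rewrite -[a]mulr1 A0 mulr0; apply: ideal_of0. Qed.

(** The coefficients of a combination of elements of a finite family. *)
Lemma ideal_of_range T (I : finType) (f : I -> A) a :
  (forall t, T t -> exists i, t = f i) -> ideal_of T a ->
  exists d : I -> A, a = \sum_i d i * f i.
Proof.
move=> Tf; elim=> [|c t b /Tf[i ->] _ [d ->]].
  by exists (fun=> 0); rewrite big1 // => i _; rewrite mul0r.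
exists (fun j => (if j == i then c else 0) + d j).
under [RHS]eq_bigr => j _ do rewrite mulrDl.
rewrite big_split; congr (_ + _).
rewrite (bigD1 i) //= eqxx big1 ?addr0 // => j /negbTE->; exact: mul0r.
Qed.

(** The radical of an ideal is closed under sums, so that the unit ideal is
    generated by powers as soon as it is generated by the elements. *)
Lemma ideal_of_pow T (I : finType) (c f : I -> A) :
  \sum_i c i * f i = 1 -> (forall i, exists m, ideal_of T (f i ^+ m)) ->
  ideal_of T 1.
Proof.
move=> cf Tf; suff [m]: exists m, ideal_of T (1 ^+ m) by rewrite expr1n.
rewrite -{}cf; apply: (big_ind (fun a => exists m, ideal_of T (a ^+ m))).
- by exists 1%N; apply: ideal_of0.
- move=> a b [p Ta] [q Tb]; exists (p + q)%N; rewrite exprDn.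
  apply: ideal_of_sum => i; rewrite -mulr_natl; apply: ideal_ofMl.
  have [le_qi | lt_iq] := leqP q i.
    by apply: ideal_ofMl; rewrite -(subnK le_qi) exprD; apply: ideal_ofMl.
  rewrite mulrC; apply: ideal_ofMl; rewrite -addnBA 1?ltnW // addnC exprD.
  exact: ideal_ofMl.
- move=> i _; have [m Tm] := Tf i; exists m; rewrite exprMn.
  exact: ideal_ofMl.
Qed.

End Ideals.

Lemma unit_idealE (K : fieldType) (A : kalg K) (T : A -> Prop) :
  unit_ideal T <-> ideal_of T 1.
Proof.
split=> [[m [c [t [Tt <-]]]] | ].
  by apply: ideal_of_sum => i; apply/ideal_ofMl/ideal_of_gen.
rewrite /unit_ideal; elim=> [|c t a Tt _ [m [d [u [Tu <-]]]]].
  by exists 0%N, (fun=> 0), (fun=> 0); split=> [[]|] //; rewrite big_ord0.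
exists m.+1, (fun i => oapp d c (unlift ord0 i)),
  (fun i => oapp u t (unlift ord0 i)); split=> [i|].
  by case: (unlift ord0 i) => [j|] /=.
rewrite big_ord_recl unlift_none /=; congr (_ + _).
by apply: eq_bigr => i _; rewrite liftK.
Qed.

(** * Gluing along a cover by localizations *)

Section Gluing.

Variables (K : fieldType) (A : kalg K) (r : nat) (f : 'I_r -> A).
Variables (B : 'I_r -> kalg K) (loc : forall i, khom A (B i)).
Hypothesis fP : exists c : 'I_r -> A, \sum_(i < r) c i * f i = 1.
Hypothesis locP : forall i, is_localization (f i) (loc i).

Lemma is_localization_cancel (R S : kalg K) (g : R) (h : khom R S) (m : nat) :
  is_localization g h -> forall a b : S, a * h g ^+ m = b * h g ^+ m -> a = b.
Proof.
move=> [[u ug] _ _] a b E.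
have cE c : u ^+ m * (c * h g ^+ m) = c by rewrite mulrCA -exprMn ug expr1n mulr1.
by rewrite -[a]cE E cE.
Qed.

(** An ideal is the unit ideal as soon as it is so in every localization. *)
Lemma ideal_of_local (T : A -> Prop) :
  (forall i, ideal_of (fun b => exists2 t, T t & b = loc i t) 1) ->
  ideal_of T 1.
Proof.
move=> Tloc; have [c cf] := fP; apply: (ideal_of_pow cf) => i.
have [[u uf] frac ker] := locP i.
(* Denominators are cleared in a combination of images of elements of T. *)
have clear b : ideal_of (fun b => exists2 t, T t & b = loc i t) b ->
    exists m a, ideal_of T a /\ b * loc i (f i) ^+ m = loc i a.
  elim=> [|d _ b' [t Tt ->] _ [m [a [Ta E]]]].
    by exists 0%N, 0; rewrite mul0r rmorph0; split=> //; apply: ideal_of0.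
  have [d' [p dE]] := frac d.
  exists (m + p)%N, (f i ^+ m * d' * t + f i ^+ p * a); split.
    apply: ideal_ofD; apply: ideal_ofMl => //; exact: ideal_of_gen.
  by rewrite rmorphD !rmorphM !rmorphXn /= -dE -E exprD; ring.
have [m [a [Ta]]] := clear _ (Tloc i).
rewrite mul1r -rmorphXn => /eqP; rewrite -subr_eq0 -rmorphB /= => /eqP/ker[p E].
exists (p + m)%N; rewrite exprD -[_ ^+ m](subrK a) mulrDr E add0r.
exact: ideal_ofMl.
Qed.

(** A section is determined by its restrictions to a cover. *)
Lemma loc_inj (a b : A) : (forall i, loc i a = loc i b) -> a = b.
Proof.
move=> ab; apply/eqP; rewrite -subr_eq0; apply/eqP.
(* The annihilator of a - b contains a power of each f i, hence 1. *)
pose T (t : A) := t * (a - b) = 0.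
suff : ideal_of T 1.
  by rewrite -[a - b]mul1r; elim=> [|c t d Tt _ IH];
    rewrite ?mul0r // mulrDl IH -mulrA Tt mulr0 addr0.
have [c cf] := fP; apply: (ideal_of_pow cf) => i; have [_ _ ker] := locP i.
have [m E] : exists m, f i ^+ m * (a - b) = 0.
  by apply: ker; rewrite rmorphB /= ab subrr.
by exists m; apply: ideal_of_gen.
Qed.

Variables (C : 'I_r -> 'I_r -> kalg K).
Variables (resl : forall i j, khom (B i) (C i j)).
Variables (resr : forall i j, khom (B j) (C i j)).
Hypothesis ovlP : forall i j,
  is_localization (f i * f j) (fun a => resl i j (loc i a)).
Hypothesis resE : forall i j a, resl i j (loc i a) = resr i j (loc j a).

(** A common exponent for finitely many eventual properties. *)
Lemma finite_bound (I : finType) (P : I -> nat -> Prop) :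
  (forall i m p, P i m -> P i (m + p)%N) ->
  (forall i, exists m, P i m) -> exists m, forall i, P i m.
Proof.
move=> Pmono /fin_all_exists[m Pm]; exists (\sum_i m i)%N => i.
by rewrite (bigD1 i) //=; apply: Pmono.
Qed.

(** With x i = b i / f i ^ M, where b i * f j ^ M = b j * f i ^ M, and
    1 = sum_i d i * f i ^ M, the sections are glued by sum_j d j * b j. *)
Lemma glue_sections (x : forall i, B i) :
  (forall i j, resl i j (x i) = resr i j (x j)) ->
  exists a : A, forall i, loc i a = x i.
Proof.
move=> xE.
have [m /fin_all_exists[a aE]] :
    exists m, forall i, exists a, x i * loc i (f i) ^+ m = loc i a.
  apply: finite_bound => [i m p [a aE] | i].
    by exists (a * f i ^+ p); rewrite exprD mulrA aE rmorphM rmorphXn.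
  by have [_ frac _] := locP i; have [a [m E]] := frac (x i); exists m, a.
have [p pE] : exists p, forall ij : 'I_r * 'I_r,
    (f ij.1 * f ij.2) ^+ p * (a ij.1 * f ij.2 ^+ m - a ij.2 * f ij.1 ^+ m) = 0.
  apply: finite_bound => [[i j] p q E | [i j] /=].
    by rewrite addnC exprD -mulrA E mulr0.
  have [_ _ ker] := ovlP i j; apply: ker.
  rewrite !rmorphB !rmorphM !rmorphXn /= -aE !(resE _ _ (a j)) -!aE.
  by rewrite !rmorphM !rmorphXn /= xE !resE; ring.
pose b i := a i * f i ^+ p; pose M := (m + p)%N.
have bE i j : b i * f j ^+ M = b j * f i ^+ M.
  apply/eqP; rewrite -subr_eq0 -[X in _ == X](pE (i, j)) /= /b /M.
  by apply/eqP; rewrite exprMn !exprD; ring.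
have [c cf] := fP.
have [d dE] : exists d : 'I_r -> A, 1 = \sum_i d i * f i ^+ M.
  apply: (@ideal_of_range A (fun t => exists i, t = f i ^+ M)) => //.
  apply: (ideal_of_pow cf) => i; exists M.
  by apply: ideal_of_gen; exists i.
exists (\sum_j d j * b j) => i; apply: (is_localization_cancel (m := M) (locP i)).
have -> : x i * loc i (f i) ^+ M = loc i (b i).
  by rewrite /M exprD mulrA aE -rmorphXn -rmorphM.
rewrite -rmorphXn -rmorphM; congr (loc i _).
rewrite mulr_suml -[RHS]mul1r dE mulr_suml; apply: eq_bigr => j _.
by rewrite -mulrA bE; ring.
Qed.

End Gluing.

(** * Evaluation of polynomials *)

Section Evaluation.

Variables (K : fieldType) (N : nat).

Section EvalMorphism.

Variables (A : kalg K) (v : 'rV[A]_N).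

(** Over the zero ring there is nothing to prove; over a nonzero ring this is
    the evaluation morphism [mmap]. *)
Lemma eval_mpoly_morph :
  additive (eval_mpoly v) /\ multiplicative (eval_mpoly v).
Proof.
have [A0 | A1] := eqVneq (1 : A) 0.
  have eqA (a b : A) : a = b by rewrite -[a]mul1r -[b]mul1r A0 !mul0r.
  by split; [move=> p q | split=> [p q|]]; apply: eqA.
pose R : comNzRingType :=
  HB.pack_for comNzRingType (GRing.ComPzRing.sort (kcarrier A))
    (GRing.PzSemiRing_isNonZero.Build (kcarrier A) A1).
pose phi : {rmorphism K -> R} := kstr A.
by split; [exact: (@mmap_is_additive N K R (v 0) phi)
          | exact: (@mmap_is_multiplicative N K R (v 0) phi)].
Qed.

HB.instance Definition _ := GRing.isAdditive.Build
  {mpoly K[N]} A (eval_mpoly v) (proj1 eval_mpoly_morph).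
HB.instance Definition _ := GRing.isMultiplicative.Build
  {mpoly K[N]} A (eval_mpoly v) (proj2 eval_mpoly_morph).

Lemma eval_mpolyC c : eval_mpoly v c%:MP = kstr A c.
Proof.
rewrite /eval_mpoly msuppC; have [-> | c0] := eqVneq c 0.
  by rewrite big_nil rmorph0.
by rewrite big_seq1 mcoeffC eqxx mulr1 big1 ?mulr1 // => i _; rewrite mnm0E.
Qed.

Lemma eval_mpolyX i : eval_mpoly v 'X_i = v 0 i.
Proof.
rewrite /eval_mpoly msuppX big_seq1 mcoeffX eqxx rmorph1 mul1r (bigD1 i) //=.
rewrite mnm1E eqxx expr1 big1 ?mulr1 // => j; rewrite eq_sym => /negbTE ji.
by rewrite mnm1E ji.
Qed.

End EvalMorphism.

(** The polynomial ring as a K-algebra, and evaluation at a point of affine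
    space as a morphism of K-algebras. *)
Definition mpoly_kalg : kalg K :=
  @KAlg K {mpoly K[N]} (@mpolyC N K).

Definition eval_hom (A : kalg K) (v : 'rV[A]_N) : khom mpoly_kalg A :=
  @KHom K mpoly_kalg A (eval_mpoly v) (eval_mpolyC v).

End Evaluation.

Section Extension.

Variables (K : fieldType) (N : nat).

(** A polynomial in the first [N] of [N + 1] variables. *)
Definition mpoly_lift (p : {mpoly K[N]}) : {mpoly K[N + 1]} :=
  mmap (@mpolyC (N + 1) K) (fun i => 'X_(lshift 1 i)) p.

Lemma eval_mpoly_lift (A : kalg K) (v : 'rV[A]_(N + 1)) p :
  eval_mpoly v (mpoly_lift p) = eval_mpoly (lsubmx v) p.
Proof.
rewrite /mpoly_lift /mmap rmorph_sum; apply: eq_bigr => m _.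
rewrite rmorphM /= eval_mpolyC rmorph_prod; congr (_ * _); apply: eq_bigr => i _.
by rewrite rmorphXn /= eval_mpolyX mxE.
Qed.

End Extension.

(** * Locally closed subfunctors of affine space *)

(** A natural one-to-one correspondence is an isomorphism of functors. *)
Lemma kiso_of_rel (K : fieldType) (X Y : kfunctor K)
    (R : forall A : kalg K, X A -> Y A -> Prop) :
  (forall (A B : kalg K) (h : khom A B) x y, R A x y -> R B (fmap h x) (fmap h y)) ->
  (forall A x, exists y, R A x y) -> (forall A y, exists x, R A x y) ->
  (forall A x y y', R A x y -> R A x y' -> y = y') ->
  (forall A x x' y, R A x y -> R A x' y -> x = x') -> kiso X Y.
Proof.
move=> Rnat Rx Ry Rfun Rinj.
pose f A x := proj1_sig (constructive_indefinite_description _ (Rx A x)).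
pose g A y := proj1_sig (constructive_indefinite_description _ (Ry A y)).
have fP A x : R A x (f A x).
  exact: (proj2_sig (constructive_indefinite_description _ (Rx A x))).
have gP A y : R A (g A y) y.
  exact: (proj2_sig (constructive_indefinite_description _ (Ry A y))).
have fnat A B (h : khom A B) x : f B (fmap h x) = fmap h (f A x).
  exact: Rfun (fP _ _) (Rnat _ _ _ _ _ (fP _ _)).
have gnat A B (h : khom A B) y : g B (fmap h y) = fmap h (g A y).
  exact: Rinj (gP _ _) (Rnat _ _ _ _ _ (gP _ _)).
exists (KMor fnat), (KMor gnat); split=> A z /=.
  exact: Rinj (gP _ _) (fP _ _).
exact: Rfun (fP _ _) (gP _ _).
Qed.

Section LocallyClosed.

Variables (K : fieldType) (N : nat) (X : kfunctor K).
Variables (e : kmor X (affine_space K N)).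
Variables (S : {mpoly K[N]} -> Prop) (I : finType) (T : I -> {mpoly K[N]}).

(** [e] identifies [X] with the locally closed subscheme of affine [N]-space
    on which the polynomials in [S] vanish and the [T i] generate the unit
    ideal. *)
Definition locus_embedding : Prop :=
  (forall A, injective (e A)) /\
  forall (A : kalg K) (v : 'rV[A]_N), (exists x, e A x = v) <->
    (forall p, S p -> eval_mpoly v p = 0) /\
    ideal_of (fun a => exists i, a = eval_mpoly v (T i)) 1.

Hypothesis eP : locus_embedding.

Let einj A : injective (e A) := eP.1 A.

Lemma locus_embedding_nat (A B : kalg K) (h : khom A B) (x : X A) t :
  e B (fmap h x) 0 t = h (e A x 0 t).
Proof. by rewrite (kmor_nat e h x) mxE. Qed.

Lemma locus_embedding_sheaf : zariski_sheaf X.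
Proof.
move=> A r f B loc C resl resr fcov locP ovlP resE x xE.
have /fin_all_exists[w wE] (t : 'I_N) :
    exists a : A, forall i, loc i a = e (B i) (x i) 0 t.
  apply: (glue_sections fcov locP ovlP resE) => i j.
  by rewrite -!locus_embedding_nat xE.
pose v : 'rV[A]_N := \row_t w t.
have vE i : map_mx (loc i) v = e (B i) (x i).
  by apply/rowP => t; rewrite !mxE wE.
have [y yE] : exists y, e A y = v.
  apply/eP.2; split=> [p Sp|].
    apply: (loc_inj fcov locP) => i; rewrite -eval_mpoly_map vE rmorph0.
    by have [+ _] := (eP.2 _ _).1 (ex_intro _ (x i) erefl); apply.
  apply: (ideal_of_local fcov locP) => i.
  have [_] := (eP.2 _ _).1 (ex_intro _ (x i) erefl).
  apply: ideal_of_le => _ [j ->]; apply: ideal_of_gen.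
  by exists (eval_mpoly v (T j)); [exists j | rewrite -vE eval_mpoly_map].
exists y; split=> [i | y' y'E].
  by apply: einj; rewrite (kmor_nat e (loc i) y) yE; apply: vE.
apply: einj; apply/rowP => t; apply: (loc_inj fcov locP) => i.
by rewrite yE mxE wE -y'E locus_embedding_nat.
Qed.

Lemma locus_embedding_separated : closed_immersion (kdiag X).
Proof.
split=> [A x x' [] //| A [y1 y2]].
exists (fun a => exists t, a = e A y1 0 t - e A y2 0 t) => B h /=; split.
  move=> [x [x1 x2]] _ [t ->].
  by rewrite rmorphB /= -!locus_embedding_nat -x1 -x2 subrr.
move=> E; exists (fmap h y1); congr (_, _); apply: einj; apply/rowP => t.
apply/eqP; rewrite -subr_eq0 !locus_embedding_nat -rmorphB E //.
by exists t.
Qed.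

Lemma invertible_locus_subproof i (A B : kalg K) (h : khom A B) (x : X A) :
  (exists u, u * eval_mpoly (e A x) (T i) = 1) ->
  exists u, u * eval_mpoly (e B (fmap h x)) (T i) = 1.
Proof.
move=> [u uE]; exists (h u).
by rewrite (kmor_nat e h x) eval_mpoly_map -rmorphM uE rmorph1.
Qed.

(** The locus in [X] where [T i] is invertible. *)
Definition invertible_locus i : subfun X :=
  SubFun (@invertible_locus_subproof i).

Lemma invertible_locus_open i : open_immersion (subfun_emb (invertible_locus i)).
Proof.
split=> [A x x' | A y]; first exact: sig_val_inj.
exists (fun a => a = eval_mpoly (e A y) (T i)) => B h.
rewrite unit_idealE; split=> [[[x [u uE]] /= xE] | ].
  rewrite -uE; apply/ideal_ofMl/ideal_of_gen.
  exists (eval_mpoly (e A y) (T i)) => //.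
  by rewrite xE (kmor_nat e h y) eval_mpoly_map.
move=> H; have [u uE] : exists u, u * eval_mpoly (e B (fmap h y)) (T i) = 1.
  have [|d dE] :=
      @ideal_of_range _ _ unit (fun=> h (eval_mpoly (e A y) (T i))) _ _ H.
    by move=> _ [a -> ->]; exists tt.
  exists (d tt); rewrite (kmor_nat e h y) eval_mpoly_map dE.
  by rewrite (bigD1 tt) //= big1 ?addr0 // => -[].
by exists (exist _ (fmap h y) (ex_intro _ u uE)).
Qed.

(** With the inverse of [T i] as an additional coordinate, the locus where
    [T i] is invertible is closed in affine [(N + 1)]-space. *)
Lemma invertible_locus_affine i :
  affine_finite_type (subfunctor (invertible_locus i)).
Proof.
pose U (q : {mpoly K[N + 1]}) :=
  (exists2 p, S p & q = mpoly_lift p) \/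
  q = 'X_(rshift N ord0) * mpoly_lift (T i) - 1.
exists (N + 1)%N, U.
have UP (A : kalg K) (v : 'rV[A]_(N + 1)) : zero_locus U A v <->
    (forall p, S p -> eval_mpoly (lsubmx v) p = 0) /\
    v 0 (rshift N ord0) * eval_mpoly (lsubmx v) (T i) = 1.
  split=> [Uv | [Sv Tv] _ [[p Sp ->] | ->]].
  - split=> [p Sp|]; first by rewrite -eval_mpoly_lift; apply: Uv; left; exists p.
    apply/eqP; rewrite -subr_eq0 -eval_mpoly_lift -eval_mpolyX -rmorphM.
    by rewrite -(rmorph1 (eval_mpoly v)) -rmorphB; apply/eqP/Uv; right.
  - by rewrite eval_mpoly_lift Sv.
  - by rewrite rmorphB rmorphM rmorph1 /= eval_mpolyX eval_mpoly_lift Tv subrr.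
apply: (@kiso_of_rel K (subfunctor (invertible_locus i))
  (subfunctor (zero_locus U))
  (fun A x y => e A (sval x) = lsubmx (sval y : 'rV[A]_(N + 1)))).
- move=> A B h [x xi] [y yU] /= E.
  by rewrite (kmor_nat e h x) /= E map_lsubmx.
- move=> A [x [u uE]] /=; have [Sx _] := (eP.2 _ _).1 (ex_intro _ x erefl).
  have vU : zero_locus U A (row_mx (e A x) (const_mx u)).
    by apply/UP; rewrite row_mxKl row_mxEr mxE; split.
  by exists (exist _ _ vU); rewrite /= row_mxKl.
- move=> A [y yU]; have [Sy Ty] := (UP _ _).1 yU.
  have [x xE] : exists x, e A x = lsubmx y.
    apply/eP.2; split=> //; rewrite -Ty; apply/ideal_ofMl/ideal_of_gen.
    by exists i.
  have xi : invertible_locus i A x by exists (y 0 (rshift N ord0)); rewrite xE.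
  by exists (exist _ x xi).
- move=> A [x xi] [y yU] [y' yU'] /= E E'; apply: sig_val_inj => /=.
  have [_ Ty] := (UP _ _).1 yU; have [_ Ty'] := (UP _ _).1 yU'.
  rewrite -(hsubmxK y) -(hsubmxK y') -E -E'; congr row_mx.
  apply/rowP => t; rewrite ord1 !mxE.
  rewrite -[LHS]mulr1 -Ty' -E' E mulrCA Ty mulr1 //.
- move=> A [x xi] [x' xi'] y /= E E'; apply: sig_val_inj => /=.
  by apply: einj; rewrite E E'.
Qed.

Lemma locus_embedding_var : is_var X.
Proof.
split; [exact: locus_embedding_sheaf | | exact: locus_embedding_separated].
exists #|I|, (fun j => invertible_locus (enum_val j)); split.
- by move=> j; apply: invertible_locus_open.
- by move=> j; apply: invertible_locus_affine.
move=> [L iL x] /=.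
have [_ Tx] := (eP.2 _ _).1 (ex_intro _ x erefl).
have [/existsP[i Tn0] | /existsPn T0] :=
  boolP [exists i, eval_mpoly (e _ x) (T i) != 0 :> L]; last first.
  have /eqP : (1 : L) = 0.
    apply: (@ideal_of_zero (KAlg iL) _ _ 1 Tx) => _ [i ->].
    by have /negPn/eqP := T0 i.
  by rewrite oner_eq0.
exists (enum_rank i), ((eval_mpoly (e _ x) (T i) : L)^-1).
by rewrite enum_rankK; apply: mulVf.
Qed.

End LocallyClosed.

(** * Immersions and complements defined by equations *)

Section Immersions.

Variables (K : fieldType) (X : kfunctor K).

(** A subset of [A] for each [A]-point of [X], regarded as a set of equations
    on that point and compatible with base change. *)
Definition natural_equations (E : forall A : kalg K, X A -> A -> Prop) : Prop :=
  forall (A B : kalg K) (h : khom A B) (x : X A) b,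
    E B (fmap h x) b <-> exists2 a, E A x a & b = h a.

Variable E : forall A : kalg K, X A -> A -> Prop.
Hypothesis E_nat : natural_equations E.

Lemma natural_equations_unit (A B : kalg K) (h : khom A B) (x : X A) :
  unit_ideal (E (fmap h x)) <->
  unit_ideal (fun b => exists2 a, E x a & b = h a).
Proof.
by split=> /unit_idealE H; apply/unit_idealE;
  apply: ideal_of_le H => t /E_nat ?; apply: ideal_of_gen.
Qed.

Lemma closed_immersion_of_equations (Z : kfunctor K) (z : kmor Z X) :
  (forall A, injective (z A)) ->
  (forall A x, (exists w, z A w = x) <-> (forall a, E x a -> a = 0)) ->
  closed_immersion z.
Proof.
move=> zinj zE; split=> // A x; exists (E x) => B h; rewrite zE; split.
  by move=> H a Ea; apply/H/E_nat; exists a.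
by move=> H b /E_nat[a Ea ->]; apply: H.
Qed.

Lemma open_immersion_of_equations (U : kfunctor K) (u : kmor U X) :
  (forall A, injective (u A)) ->
  (forall A x, (exists w, u A w = x) <-> unit_ideal (E x)) ->
  open_immersion u.
Proof.
by move=> uinj uE; split=> // A x; exists (E x) => B h;
  rewrite uE natural_equations_unit.
Qed.

Lemma same_point_refl (p : kpoint X) : same_point p p.
Proof.
exists (kp_field p), (@kp_str K X p).
by exists (@KHom K (KAlg (kp_str p)) (KAlg (kp_str p)) idfun (fun=> erefl)),
  (@KHom K (KAlg (kp_str p)) (KAlg (kp_str p)) idfun (fun=> erefl)).
Qed.

(** Over a field the equations generate the unit ideal exactly when one of them
    fails, and neither condition changes under a field extension. *)
Lemma image_complement_of_equations (U Z : kfunctor K) (u : kmor U X)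
    (z : kmor Z X) :
  (forall A x, (exists w, u A w = x) <-> unit_ideal (E x)) ->
  (forall A x, (exists w, z A w = x) <-> (forall a, E x a -> a = 0)) ->
  image_is_complement u z.
Proof.
move=> uE zE [L iL x]; split.
  move=> [[Lq iq q] [M [iM [f [g /= fg]]]]] [[Lw iw w] [M' [iM' [f' [g' /= fg']]]]].
  have x0 a : E x a -> a = 0.
    move=> Ea; pose phi : {rmorphism L -> M'} := khom_fun g'.
    apply/eqP; rewrite -(fmorph_eq0 phi); apply/eqP.
    have /zE : exists w', z (KAlg iM') w' = fmap g' x.
      by exists (fmap f' w); rewrite kmor_nat.
    by apply; apply/E_nat; exists a.
  have /uE/natural_equations_unit/unit_idealE H :
      exists q', u (KAlg iM) q' = fmap g x.
    by exists (fmap f q); rewrite kmor_nat.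
  have /eqP : (1 : M) = 0.
    by apply: (ideal_of_zero _ H) => _ [a /x0-> ->]; rewrite rmorph0.
  by rewrite oner_eq0.
move=> nz; have [a Ea a0] : exists2 a : L, E x a & a != 0.
  apply: NNPP => H; apply: nz.
  have [a Ea|w wE] := (zE (KAlg iL) x).2.
    by apply/eqP/negPn/negP => a0; apply: H; exists a.
  exists (KPoint w); rewrite /push_point /= wE; exact: same_point_refl.
have /uE[w wE] : unit_ideal (E x).
  apply/unit_idealE; rewrite -[1](mulVf a0 : _ = 1 :> L).
  exact/ideal_ofMl/ideal_of_gen.
exists (KPoint w); rewrite /push_point /= wE; exact: same_point_refl.
Qed.

End Immersions.

Section Subfunctors.

Variables (K : fieldType) (X : kfunctor K) (P Q : subfun X).

Lemma subfun_emb_inj A : injective (subfun_emb P A).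
Proof. by move=> x y; apply: sig_val_inj. Qed.

Lemma subfun_emb_image (A : kalg K) (x : X A) :
  (exists w, subfun_emb P A w = x) <-> P A x.
Proof. by split=> [[[w Pw] /= <-] | Px] //; exists (exist _ x Px). Qed.

Variable PQ : subfun_le P Q.

Lemma incl_inj A : injective (incl PQ A).
Proof. by move=> x y /(congr1 sval) /= xy; apply: sig_val_inj. Qed.

Lemma incl_image (A : kalg K) (x : subfunctor Q A) :
  (exists w, incl PQ A w = x) <-> P A (sval x).
Proof.
split=> [[[w Pw] /= <-] | Px] //.
by exists (exist _ (sval x) Px); apply: sig_val_inj.
Qed.

Lemma natural_equations_sub (E : forall A : kalg K, X A -> A -> Prop) :
  natural_equations E ->
  @natural_equations K (subfunctor Q) (fun A x => E A (sval x)).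
Proof. by move=> E_nat A B h x b; apply: E_nat. Qed.

End Subfunctors.

(** * Minors *)

Section Minors.

Variables (A : comPzRingType) (n : nat).
Implicit Types (x : 'M[A]_n) (a : A).

(** Laplace expansion along the first row. *)
Lemma is_minor_expand r x a : is_minor r.+1 x a -> ideal_of (is_minor r x) a.
Proof.
move=> [f [g [fi gi ->]]]; rewrite (expand_det_row _ ord0).
apply: ideal_of_sum => j; do 2!apply: ideal_ofMl; apply: ideal_of_gen.
have lift_homo (i : 'I_r.+1) : {homo lift i : p q / (p < q)%N}.
  by move=> p q; rewrite !ltnNge /= leq_bump2.
exists (f \o lift ord0), (g \o lift j); split.
- by move=> p q pq; apply/fi/lift_homo.
- by move=> p q pq; apply/gi/lift_homo.
- by congr (\det _); apply/matrixP => p q; rewrite !mxE.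
Qed.

Lemma is_minor_le r s x a : (r <= s)%N ->
  is_minor s x a -> ideal_of (is_minor r x) a.
Proof.
move=> /subnK<-; elim: (s - r)%N a => [|d IH] a; first exact: ideal_of_gen.
by rewrite addSn => /is_minor_expand; apply: ideal_of_le.
Qed.

(** The equations of the condition that the rank is at most [j], where no
    matrix has rank at most [-1]. *)
Definition rank_equations (j : int) x a : Prop :=
  if j is Posz l then is_minor l.+1 x a else a = 1.

Lemma rank_equations_le i j x a : i <= j ->
  rank_equations j x a -> ideal_of (rank_equations i x) a.
Proof.
case: i j => [i|i] [j|j] //= ij.
- by apply: is_minor_le; rewrite ltnS -lez_nat.
- by move=> _; rewrite -[a]mulr1; apply/ideal_ofMl/ideal_of_gen.
- exact: ideal_of_gen.
Qed.

(** Strictly increasing maps, which select the rows or the columns of a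
    minor. *)
Definition increasing_map r (f : {ffun 'I_r -> 'I_n}) : bool :=
  [forall p : 'I_r, forall q : 'I_r, (p < q)%N ==> (f p < f q)%N].

Definition minor_at r
    (t : {f | @increasing_map r f} * {f | @increasing_map r f}) x : A :=
  \det (mxsub (val t.1) (val t.2) x).

Lemma is_minorP r x a : is_minor r x a <-> exists t, a = @minor_at r t x.
Proof.
split=> [[f [g [fi gi ->]]] | [[[f fi] [g gi]] ->]].
  have incP (h : 'I_r -> 'I_n) : {homo h : p q / (p < q)%N} ->
      increasing_map [ffun p => h p].
    by move=> hi; apply/forallP => p; apply/forallP => q; apply/implyP;
      rewrite !ffunE; apply: hi.
  exists (exist (@increasing_map r) _ (incP f fi),
          exist (@increasing_map r) _ (incP g gi)).
  by congr (\det _); apply/matrixP => p q; rewrite !mxE !ffunE.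
by exists f, g; split=> // p q pq;
  [move/forallP: fi => /(_ p)/forallP/(_ q)
  | move/forallP: gi => /(_ p)/forallP/(_ q)]; rewrite pq.
Qed.

End Minors.

(** * Rank loci of symmetric matrices *)

Section Loci.

Variable K : fieldType.

Lemma rank_equations_map (A B : kalg K) (h : khom A B) (n : nat) (j : int)
    (x : 'M[A]_n) (b : B) :
  rank_equations j (map_mx h x) b <-> exists2 a, rank_equations j x a & b = h a.
Proof.
case: j => [l|l] /=; first exact: is_minor_map.
by split=> [-> | [a -> ->]]; [exists 1; rewrite ?rmorph1 | rewrite rmorph1].
Qed.

Lemma sym_rangeP n i j (A : kalg K) (x : Sym K n A) :
  sym_range K n i j A x <->
  sym_ge K n i A x /\ forall a, rank_equations j (sval x) a -> a = 0.
Proof.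
case: j => [l|l] //=; split=> [A0 | [_ ]]; last exact.
by split=> [|_ -> //]; apply/unit_idealE/ideal_of_trivial.
Qed.

Lemma sym_ge_le n i j (A : kalg K) (x : Sym K n A) : (i <= j)%N ->
  sym_ge K n j A x -> sym_ge K n i A x.
Proof.
move=> ij /unit_idealE H; apply/unit_idealE; apply: ideal_of_le H => a.
exact: is_minor_le.
Qed.

Lemma sym_ge0 n (A : kalg K) (x : Sym K n A) : sym_ge K n 0 A x.
Proof.
apply/unit_idealE/ideal_of_gen.
have f0 : 'I_0 -> 'I_n by case.
by exists f0, f0; split=> [[]|[]|] //; rewrite det_mx00.
Qed.

Lemma sym_range_le n i i' j j' (A : kalg K) (x : Sym K n A) :
  (i' <= i)%N -> j <= j' -> sym_range K n i j A x -> sym_range K n i' j' A x.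
Proof.
move=> ii' jj' /sym_rangeP[xi xj]; apply/sym_rangeP; split.
  exact: sym_ge_le xi.
by move=> a /(rank_equations_le jj') /(ideal_of_zero xj).
Qed.

Definition sym_entries_fun n (A : kalg K) (x : Sym K n A) : 'rV[A]_(n * n) :=
  mxvec (sval x).

Lemma sym_entries_nat n (A B : kalg K) (h : khom A B) (x : Sym K n A) :
  sym_entries_fun (fmap h x) = map_mx h (sym_entries_fun x).
Proof. by rewrite /sym_entries_fun /= map_mxvec. Qed.

(** The entries of a symmetric matrix as a point of affine space. *)
Definition sym_entries n : kmor (Sym K n) (affine_space K (n * n)) :=
  @KMor K (Sym K n) (affine_space K (n * n)) (@sym_entries_fun n)
    (@sym_entries_nat n).

Section Presentation.

Variables (n k i : nat) (j : int).

(** The matrix of coordinate functions. *)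
Definition generic_mx : 'M[{mpoly K[n * n]}]_n := vec_mx (\row_t 'X_t).

Lemma map_generic_mx (A : kalg K) (v : 'rV[A]_(n * n)) :
  map_mx (eval_hom v) generic_mx = vec_mx v.
Proof.
rewrite map_vec_mx; congr vec_mx.
by apply/rowP => t; rewrite !mxE /= eval_mpolyX.
Qed.

Let skip (R : Type) (x : 'M[R]_n) : 'M[R]_n.-1 := mxsub (@skip1 n) (@skip1 n) x.

(** The equations of the locus of symmetric matrices of rank at most [k] whose
    submatrix without the first row and column has rank between [i] and [j].
    They express symmetry and the two upper bounds. *)
Definition locus_equations (p : {mpoly K[n * n]}) : Prop :=
  [\/ exists a b, p = generic_mx a b - generic_mx b a,
      is_minor k.+1 generic_mx p
    | rank_equations j (skip generic_mx) p].

(** The lower bound: on this locus these polynomials generate the unit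
    ideal. *)
Definition locus_minors
    (t : {f | @increasing_map n.-1 i f} * {f | @increasing_map n.-1 i f}) :
    {mpoly K[n * n]} :=
  minor_at t (skip generic_mx).

Lemma locus_equationsP (A : kalg K) (v : 'rV[A]_(n * n)) :
  (forall p, locus_equations p -> eval_mpoly v p = 0) <->
  [/\ (vec_mx v)^T = vec_mx v :> 'M_n,
      forall a, is_minor k.+1 (vec_mx v : 'M_n) a -> a = 0
    & forall a, rank_equations j (skip (vec_mx v)) a -> a = 0].
Proof.
have vE a b : vec_mx v a b = eval_mpoly v (generic_mx a b).
  by rewrite -map_generic_mx mxE.
split=> [H | [vT vk vj] p [[a [b ->]] | pk | pj]].
- split=> [|a|a].
  + apply/matrixP => a b; rewrite mxE; apply/eqP; rewrite -subr_eq0 !vE -rmorphB.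
    by apply/eqP/H; constructor 1; exists b, a.
  + by rewrite -map_generic_mx => /is_minor_map[p pk ->]; apply: H; constructor 2.
  + rewrite -map_generic_mx /skip -map_mxsub => /rank_equations_map[p pj ->].
    by apply: H; constructor 3.
- by rewrite rmorphB /= -!vE -[in X in X - _]vT mxE subrr.
- by apply: vk; rewrite -map_generic_mx; apply/is_minor_map; exists p.
- apply: vj; rewrite -map_generic_mx /skip -map_mxsub.
  by apply/rank_equations_map; exists p.
Qed.

Lemma locus_minorsE (A : kalg K) (v : 'rV[A]_(n * n)) t :
  eval_mpoly v (locus_minors t) = minor_at t (skip (vec_mx v)).
Proof.
rewrite /locus_minors /minor_at -map_generic_mx /skip -!map_mxsub.
by rewrite det_map_mx.
Qed.

(** A functor identified with such a locus is an object of Var_K. *)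
Lemma sym_locus_var (X : kfunctor K) (e : kmor X (Sym K n)) :
  (forall A, injective (e A)) ->
  (forall A x, (exists u, e A u = x) <->
     sym_le K n k A x /\ sym_range K n.-1 i j A (del11 K n A x)) ->
  is_var X.
Proof.
move=> einj eim.
apply: (@locus_embedding_var K _ X (kmor_comp (sym_entries n) e)
          locus_equations _ locus_minors); split.
  move=> A u u' /(can_inj mxvecK) uu'; apply: einj; exact: sig_val_inj.
move=> A v; rewrite locus_equationsP.
have unitE : ideal_of (fun a => exists t, a = eval_mpoly v (locus_minors t)) 1 <->
    unit_ideal (is_minor i (skip (vec_mx v))).
  rewrite unit_idealE; split; apply: ideal_of_le => a.
    by move=> [t ->]; apply/ideal_of_gen/is_minorP; exists t; apply: locus_minorsE.
  by move=> /is_minorP[t ->]; apply: ideal_of_gen; exists t; rewrite locus_minorsE.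
split=> [[u uv] | [[vT vk vj] vi]].
  have xE : vec_mx v = sval (e A u) by rewrite -uv /= /sym_entries_fun mxvecK.
  have [uk /sym_rangeP[ui uj]] := (eim _ _).1 (ex_intro _ u erefl).
  split; last by apply/unitE; rewrite xE.
  by rewrite xE; split=> //; exact: (proj2_sig (e A u)).
have [|u uE] := (eim A (exist _ (vec_mx v) vT)).2.
  by split=> //; apply/sym_rangeP; split=> //; apply/unitE.
by exists u; rewrite /= uE /sym_entries_fun /= vec_mxK.
Qed.

End Presentation.

End Loci.

(** * The strata *)

Section Strata.

Variables (K : fieldType) (n k : nat).
Let Y (i : nat) (j : int) := Yij K n k i j.

Let del (A : kalg K) (x : SymLe K n k A) : 'M[A]_n.-1 :=
  sval (del11 K n A (sval x)).

Lemma minors_natural r :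
  natural_equations (fun A (x : SymLe K n k A) => is_minor r (del x)).
Proof. by move=> A B h x b; rewrite /del /= -map_mxsub; apply: is_minor_map. Qed.

Lemma rank_equations_natural j :
  natural_equations (fun A (x : SymLe K n k A) => rank_equations j (del x)).
Proof.
by move=> A B h x b; rewrite /del /= -map_mxsub; apply: rank_equations_map.
Qed.

Lemma Yij_le i i' j j' : (i' <= i)%N -> j <= j' -> subfun_le (Y i j) (Y i' j').
Proof. by move=> ii' jj' A x; apply: sym_range_le. Qed.

Lemma Yij_incl_closed i j j' (z : subfun_le (Y i j) (Y i j')) :
  closed_immersion (incl z).
Proof.
apply: (closed_immersion_of_equations
  (natural_equations_sub (rank_equations_natural j))).
  exact: incl_inj.
move=> A [x xY]; rewrite incl_image; have [xi _] := (sym_rangeP _ _ _).1 xY.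
by split=> [/sym_rangeP[] // | xj]; apply/sym_rangeP.
Qed.

Lemma Yij_incl_open i i' j (u : subfun_le (Y i' j) (Y i j)) :
  open_immersion (incl u).
Proof.
apply: (open_immersion_of_equations
  (natural_equations_sub (minors_natural i'))).
  exact: incl_inj.
move=> A [x xY]; rewrite incl_image; have [_ xj] := (sym_rangeP _ _ _).1 xY.
by split=> [/sym_rangeP[] // | xi]; apply/sym_rangeP.
Qed.

Lemma Yij_incl_complement i j m (u : subfun_le (Y j.+1 m) (Y i m))
    (z : subfun_le (Y i j%:Z) (Y i m)) :
  image_is_complement (incl u) (incl z).
Proof.
apply: (image_complement_of_equations
  (natural_equations_sub (minors_natural j.+1))) => A [x xY];
  rewrite incl_image; have [xi xm] := (sym_rangeP _ _ _).1 xY.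
  by split=> [/sym_rangeP[] // | xj]; apply/sym_rangeP.
by split=> [[] | xj].
Qed.

(** The ideal generated by the i-minors cannot be both zero and the unit ideal,
    unless the ring is zero. *)
Lemma Yij_empty i : subfun_empty (Y i (i%:Z - 1)).
Proof.
case: i => [|i] A x //; rewrite intS addrC addKr; split=> [[/unit_idealE xi x0]|A0].
  exact: ideal_of_zero xi.
by split=> [|a _]; [apply/unit_idealE/ideal_of_trivial | rewrite -[a]mul1r A0 mul0r].
Qed.

Lemma Y0_Fil j : subfun_eq (Y 0 j%:Z) (Fil K n k j).
Proof. by move=> A x; split=> [[] | xj] //; split=> //; apply: sym_ge0. Qed.

Lemma Fil_closed l : closed_immersion (subfun_emb (Fil K n k l)).
Proof.
apply: (closed_immersion_of_equations (minors_natural l.+1)).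
  exact: subfun_emb_inj.
by move=> A x; apply: subfun_emb_image.
Qed.

Lemma Fil_incl_closed l : closed_incl (Fil K n k l) (Fil K n k l.+1).
Proof.
have z : subfun_le (Fil K n k l) (Fil K n k l.+1).
  by move=> A x xl a /is_minor_expand/(ideal_of_zero xl).
exists z; apply: (closed_immersion_of_equations
  (natural_equations_sub (minors_natural l.+1))); first exact: incl_inj.
by move=> A x; apply: incl_image.
Qed.

Lemma SymLe_var : is_var (SymLe K n k).
Proof.
apply: (@sym_locus_var K n k 0 k%:Z _ (subfun_emb _)) => [A|A x].
  exact: subfun_emb_inj.
rewrite subfun_emb_image; split=> [xk | [] //]; split=> //.
by split; [apply: sym_ge0 | apply: del11_le].
Qed.

Lemma Yij_var i j : is_var (subfunctor (Y i j)).
Proof.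
apply: (@sym_locus_var K n k i j _ (kmor_comp (subfun_emb _) (subfun_emb _))).
  by move=> A x y /= /sig_val_inj/sig_val_inj.
move=> A x; split=> [[[[y yk] yY] /= <-] // | [xk xY]].
have xY' : Y i j A (exist _ x xk) by [].
by exists (exist _ _ xY').
Qed.

End Strata.

Theorem proposition2p3 (K : fieldType) (charK : 2%N \notin [pchar K])
    (n k : nat) (ltkn : (k < n)%N) :
  let F (l : nat) := Fil K n k l in
  let Y (i : nat) (j : int) := Yij K n k i j in
  (* F_0, ..., F_k is an increasing filtration by closed subschemes *)
  [/\ is_var (SymLe K n k),
      forall l : nat, (l <= k)%N -> closed_immersion (subfun_emb (F l)),
      forall l : nat, (l < k)%N -> closed_incl (F l) (F l.+1)
    & subfun_eq (F k) (subfun_full (SymLe K n k))] /\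
  (* the Y_{i,j} are the objects of a commutative triangular diagram in Var_K *)
  [/\ forall (i : nat) (j : int), (i <= k.+1)%N -> i%:Z - 1 <= j -> j <= k%:Z ->
        is_var (subfunctor (Y i j)),
      forall i : nat, (i <= k.+1)%N -> subfun_empty (Y i (i%:Z - 1)),
      forall j : nat, (j <= k)%N -> subfun_eq (Y 0%N j%:Z) (F j)
    & forall (i : nat) (j : int), i%:Z <= j -> j < k%:Z ->
        forall (v : subfun_le (Y i.+1 j) (Y i j))
               (h : subfun_le (Y i j) (Y i (j + 1)))
               (h' : subfun_le (Y i.+1 j) (Y i.+1 (j + 1)))
               (v' : subfun_le (Y i.+1 (j + 1)) (Y i (j + 1))),
        kmor_eq (kmor_comp (incl h) (incl v)) (kmor_comp (incl v') (incl h'))] /\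
  [/\ (* (1) *)
      forall (i : nat) (j : int), (i <= k.+1)%N -> i%:Z - 1 <= j -> j < k%:Z ->
        closed_incl (Y i j) (Y i (j + 1)),
      (* (2) *)
      forall (i : nat) (j : int), (i <= k)%N -> i%:Z <= j -> j <= k%:Z ->
        open_incl (Y i.+1 j) (Y i j)
    & (* (3) *)
      forall i j m : nat, (i <= j)%N -> (j <= m)%N -> (m <= k)%N ->
        exists (u : subfun_le (Y j.+1 m%:Z) (Y i m%:Z))
               (z : subfun_le (Y i j%:Z) (Y i m%:Z)),
          closed_immersion (incl z) /\ image_is_complement (incl u) (incl z)].
Proof.
move=> F Y; split; [split | split; split].
- exact: SymLe_var.
- by move=> l _; apply: Fil_closed.
- by move=> l _; apply: Fil_incl_closed.
- by move=> A x; split=> // _; apply: del11_le; exact: (proj2_sig x).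
- by move=> i j _ _ _; apply: Yij_var.
- by move=> i _; apply: Yij_empty.
- by move=> j _; apply: Y0_Fil.
- by move=> i j _ _ v h h' v' A x; apply: sig_val_inj.
- move=> i j _ _ _; have z : subfun_le (Y i j) (Y i (j + 1)).
    by apply: Yij_le => //; rewrite Num.Theory.lerDl.
  by exists z; apply: Yij_incl_closed.
- move=> i j _ _ _; have u : subfun_le (Y i.+1 j) (Y i j) by apply: Yij_le.
  by exists u; apply: Yij_incl_open.
- move=> i j m ij jm _.
  have u : subfun_le (Y j.+1 m%:Z) (Y i m%:Z) by apply: Yij_le => //; apply: leqW.
  have z : subfun_le (Y i j%:Z) (Y i m%:Z) by apply: Yij_le.
  exists u, z; split; [exact: Yij_incl_closed | exact: Yij_incl_complement].
Qed.
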